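(* Let $X$ be a topological space. If the Alexandroff duplicate $AD(X)$ is star-$K$-Scheepers, then $X$ is also star-$K$-Scheepers.
   Context: The Alexandroff duplicate of $X$ is $AD(X)=X\times\{0,1\}$ topologized as follows: each point of $X\times\{1\}$ is isolated, and a basic neighbourhood of $(x,0)\in X\times\{0\}$ is a set of the form $(U\times\{0\})\cup((U\times\{1\})\setminus\{(x,1)\})$, where $U$ is a neighbourhood of $x$ in $X$. For a subset $A$ of a space $Z$ and a collection $\mathcal{P}$ of subsets of $Z$, $St(A,\mathcal{P})=\bigcup\{B\in\mathcal{P}: A\cap B\neq\emptyset\}$. An open cover $\mathcal{U}$ of $Z$ is an $\omega$-cover if each finite $F\subseteq Z$ is contained in some $U\in\mathcal{U}$ (the set $Z$ itself is allowed to be a member). $Z$ is star-$K$-Scheepers if for each sequence $(\mathcal{U}_n)_{n\in\mathbb{N}}$ of open covers of $Z$ there is a sequence $(K_n)_{n\in\mathbb{N}}$ of compact subsets of $Z$ such that $\{St(K_n,\mathcal{U}_n): n\in\mathbb{N}\}$ is an $\omega$-cover of $Z$. *)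

(* Defs.v *)
From HB Require Import structures.
From mathcomp Require Import all_boot.
From mathcomp Require Import all_classical.
From mathcomp Require Import topology.

Set Implicit Arguments.
Unset Strict Implicit.
Unset Printing Implicit Defensive.

Local Open Scope classical_set_scope.

(* The carrier is X * {0,1}, with false for 0 and true for 1. The alias keeps
   it from inheriting the product topology. *)
Definition AD (X : Type) : Type := (X * bool)%type.

Section AlexandroffDuplicate.
Context {X : topologicalType}.

HB.instance Definition _ := Choice.on (AD X).

Definition AD_basic_nbhs (x : X) (U : set X) : set (AD X) :=
  (U `*` [set false]) `|` ((U `*` [set true]) `\ (x, true)).

Definition AD_nbhs (p : AD X) : set_system (AD X) :=
  if p.2 then principal_filter p
  else filter_from (nbhs p.1) (AD_basic_nbhs p.1).

(* A set is open when it contains a basic neighbourhood of each of its points.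
   When X is not T1, AD_nbhs need not satisfy the axiom nbhs_nbhs, so the
   topology is built from its open sets; AD_nbhsE below recovers the prescribed
   neighbourhoods when X is T1. *)
Definition AD_open : set_system (AD X) := [set A | A `<=` AD_nbhs^~ A].

#[local] Instance AD_nbhs_filter (p : AD X) : Filter (AD_nbhs p).
Proof.
case: p => x [] /=; first exact: principal_filter_proper.
apply: filter_from_filter; first by exists setT; exact: filterT.
move=> U V xU xV; exists (U `&` V); first exact: filterI.
by move=> q [[[Uq Vq] q2]|[[[Uq Vq] q2] qx]]; split;
  by [left; split|right; split].
Qed.

Let AD_openT : AD_open setT.
Proof. by move=> p _; exact: filterT. Qed.

Let AD_openI : setI_closed AD_open.
Proof.
by move=> A B oA oB p [Ap Bp]; apply: filterI; [exact: oA|exact: oB].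
Qed.

Let AD_open_bigU (I : Type) (f : I -> set (AD X)) :
  (forall i, AD_open (f i)) -> AD_open (\bigcup_i f i).
Proof.
move=> of_ p [i _ fip]; have := of_ i p fip.
by apply: filterS => q fiq; exists i.
Qed.

HB.instance Definition _ :=
  isOpenTopological.Build (AD X) AD_openT AD_openI AD_open_bigU.

Lemma AD_openE : @open (AD X) = AD_open.
Proof. by []. Qed.

Lemma AD_nbhsE : accessible_space X ->
  forall p : AD X, nbhs p = AD_nbhs p.
Proof.
move=> T1 p; apply/seteqP; split=> A.
  by move=> [B [oB Bp BA]]; apply: filterS BA _; exact: (oB p Bp).
case: p => x [] /=.
  move=> /principal_filterP xA; exists [set (x, true)]; split=> //.
    by move=> _ ->; exact/principal_filterP.
  by move=> _ ->.
case=> U xU UA; exists (AD_basic_nbhs x U°); split.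
- move=> [y []] [[/= yU e]|[[/= yU e] yx]] //.
    by apply/principal_filterP; right; split.
  have [->|yx] := eqVneq y x.
    by exists U° => //; exact: nbhs_interior.
  exists (U° `&` [set~ x]).
    apply: filterI; first exact: nbhs_interior.
    apply: open_nbhs_nbhs; split; last exact/eqP.
    by rewrite openC; exact: accessible_closed_set1.
  move=> [z b] [[[/= zU zx] ->]|[[[/= zU zx] ->] _]]; [by left|right].
  by split=> // -[].
- by left; split.
- apply: subset_trans UA => -[z b] [[/= zU ->]|[[/= zU ->] zx]].
    by left; split=> //; exact: interior_subset.
  by right; split=> //; split=> //; exact: interior_subset.
Qed.

End AlexandroffDuplicate.

Definition star (Z : Type) (A : set Z) (P : set (set Z)) : set Z :=
  \bigcup_(B in [set B | P B /\ A `&` B !=set0]) B.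

Definition open_cover (Z : topologicalType) (U : set (set Z)) : Prop :=
  U `<=` open /\ \bigcup_(B in U) B = [set: Z].

Definition omega_cover (Z : topologicalType) (U : set (set Z)) : Prop :=
  open_cover U /\
  forall F : set Z, finite_set F -> exists2 B, U B & F `<=` B.

Definition star_K_Scheepers (Z : topologicalType) : Prop :=
  forall U : nat -> set (set Z), (forall n, open_cover (U n)) ->
  exists2 K : nat -> set Z, (forall n, compact (K n)) &
    omega_cover [set star (K n) (U n) | n in [set: nat]].

(* Main.v *)
(** The projection [AD X -> X] is continuous, so covers of [X] pull back to
    covers of [AD X] and compact sets push forward to compact sets; the star of
    a set in a pulled back cover projects into the star of its image. *)
Require Import Defs.
From mathcomp Require Import all_boot all_classical topology.

Local Open Scope classical_set_scope.

Definition AD_proj {X : Type} (p : AD X) : X := p.1.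

(** Points [(x, true)] are isolated; at [(x, false)] the open set [A] itself serves as [U], since
    both layers of [AD_basic_nbhs x A] project into [A]. *)
Lemma AD_proj_continuous (X : topologicalType) : continuous (@AD_proj X).
Proof.
apply/continuousP => A oA; rewrite AD_openE => -[x []] /= Ax.
  exact/principal_filterP.
exists A; first exact: open_nbhs_nbhs.
by move=> q [[]|[[]]].
Qed.

Lemma open_cover_preimage (Y Z : topologicalType) (f : Y -> Z)
    (U : set (set Z)) :
  continuous f -> open_cover U -> open_cover (preimage f @` U).
Proof.
move=> /continuousP cf [oU cU]; split.
  by move=> _ [B UB <-]; apply: cf; exact: oU.
apply/seteqP; split=> // y _.
have [B UB Bfy] : (\bigcup_(B in U) B) (f y) by rewrite cU.
by exists (f @^-1` B) => //; exists B.
Qed.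

(** If the preimage of [B] meets [K] at [k], then [B] meets the image of [K] at [f k]. *)
Lemma star_preimage (Y Z : Type) (f : Y -> Z) (K : set Y) (U : set (set Z)) :
  star K (preimage f @` U) `<=` f @^-1` star (f @` K) U.
Proof.
move=> y [_ [[B UB <-] [k [Kk Bfk]]] Bfy].
by exists B => //; split=> //; exists (f k); split=> //; exists k.
Qed.

Lemma open_star (Z : topologicalType) (A : set Z) (U : set (set Z)) :
  U `<=` open -> open (star A U).
Proof. by move=> oU; apply: bigcup_open => B [UB _]; exact: oU. Qed.

Theorem theorem4p6 (X : topologicalType) :
  star_K_Scheepers (AD X) -> star_K_Scheepers X.
Proof.
move=> SK U cU.
have cp := AD_proj_continuous X.
have [K cK [_ wK]] := SK _ (fun n => open_cover_preimage _ _ _ _ cp (cU n)).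
have wX (F : set X) : finite_set F ->
    exists2 B, [set star (AD_proj @` K n) (U n) | n in [set: nat]] B
             & F `<=` B.
  move=> finF.
  (* Lift [F] to the layer of [false] by a section of [AD_proj]; an index [n] whose star contains
     the lift also works for [F]. *)
  have [_ [n _ <-] FS] := wK _ (finite_image (fun x => (x, false) : AD X) finF).
  exists (star (AD_proj @` K n) (U n)); first by exists n.
  by move=> x Fx; apply: (star_preimage _ _ _ _ _ (x, false)); apply: FS; exists x.
exists (fun n => AD_proj @` K n).
  by move=> n; apply: continuous_compact => //; exact: continuous_subspaceT.
split=> //; split.
  by move=> _ [n _ <-]; apply: open_star; have [] := cU n.
apply/seteqP; split=> // x _.
(* That the stars cover [X] is the case of singletons in [wX]. *)
have [B SB xB] := wX [set x] (finite_set1 x).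
by exists B => //; exact: xB.
Qed.
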